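(* Let $q$ be a prime power, let $M=[m_{i\gamma}\mid 1\le i\le n,\ \gamma\in\mathbb{F}]$ be a doubly indexed list of nonnegative integers, and let $M^{(s)}$, $N^{(s)}$, $h^{(s)}$ be obtained from $M$ by the inductive construction described in the context (for any admissible choices made there). Then for every integer $l\ge 0$, $$I_{M,l}=\sum_{s=0}^{l}J_{N^{(s)}}\prod_{0\le r<s}(z-h^{(r)})$$ as a module over $R$, where $J_{N^{(s)}}=R$ and $h^{(s)}=0$ for $s\ge l_{\max}$.
   Context: $\mathbb{F}$ is a finite field with $q^2$ elements. The Hermitian curve $H$ is the affine plane curve $Y^q+Y-X^{q+1}=0$ over $\mathbb{F}$, with coordinate ring $R=\mathbb{F}[X,Y]/\langle Y^q+Y-X^{q+1}\rangle=\mathbb{F}[x,y]$. $H$ has $n=q^3$ rational points $P_1,\dots,P_n$. For a rational point $P$ of $H$, $\mathfrak{m}_P=\{f\in R\mid f(P)=0\}$, and for nonzero $f\in R$, $v_P(f)$ is the largest integer $r$ with $f\in\mathfrak{m}_P^r$ ($v_P(0)=\infty$). For a rational point $S=(P_i,\gamma)$, $\gamma\in\mathbb{F}$, of $H\times\mathbb{A}^1_{\mathbb{F}}$, let $\mathfrak{m}_S=\{f\in R[z]\mid f(S)=0\}$; $\mathrm{mult}_S(f)$ is the largest integer $r$ with $f\in\mathfrak{m}_S^r$ ($\mathrm{mult}_S(0)=\infty$). $I_M=\{f\in R[z]\mid \mathrm{mult}_{(P_i,\gamma)}(f)\ge m_{i\gamma}\text{ for all }1\le i\le n,\gamma\in\mathbb{F}\}$.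 For $l\ge0$, $R[z]_l$ is the $R$-module of polynomials in $R[z]$ of $z$-degree at most $l$, and $I_{M,l}=I_M\cap R[z]_l$. For a list $N=[n_i\mid 1\le i\le n]$ of nonnegative integers, $J_N=\{f\in R\mid v_{P_i}(f)\ge n_i\text{ for all }1\le i\le n\}$. Inductive construction. Let $l_{\max}=\max_i\sum_{\gamma\in\mathbb{F}}m_{i\gamma}$, $m^{(0)}_{i\gamma}=m_{i\gamma}$, $n_i^{(0)}=\max_{\gamma\in\mathbb{F}}m_{i\gamma}$. For $s=0,1,\dots,l_{\max}-1$: for each $i$ with $n_i^{(s)}>0$ choose $\gamma_i\in\mathbb{F}$ (depending on $s$) with $m^{(s)}_{i\gamma_i}=n_i^{(s)}$; choose $h^{(s)}\in R$ with $h^{(s)}(P_i)=\gamma_i$ for each such $i$; set $m^{(s+1)}_{i\gamma}=m^{(s)}_{i\gamma}-1$ if $n_i^{(s)}>0$ and $\gamma=\gamma_i$, and $m^{(s+1)}_{i\gamma}=m^{(s)}_{i\gamma}$ otherwise; set $n_i^{(s+1)}=\max_{\gamma\in\mathbb{F}}m^{(s+1)}_{i\gamma}$. Put $M^{(s)}=[m^{(s)}_{i\gamma}]$ and $N^{(s)}=[n_i^{(s)}]$. The empty product is $1$. *)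

(* Defs.v *)
From HB Require Import structures.
From mathcomp Require Import all_boot all_algebra.
From mathcomp Require Import classical_sets.

Set Implicit Arguments.
Unset Strict Implicit.
Unset Printing Implicit Defensive.

Import GRing.Theory.

Local Open Scope ring_scope.
Local Open Scope classical_set_scope.

Definition prime_power (q : nat) : Prop :=
  exists p k : nat, [/\ prime p, (0 < k)%N & q = (p ^ k)%N].

Section Ideals.
Variable A : comNzRingType.

Definition ideal_mul (I J : set A) : set A :=
  [set f | exists s : seq (A * A),
     (forall u, u \in s -> I u.1 /\ J u.2) /\ f = \sum_(u <- s) u.1 * u.2].

Fixpoint ideal_exp (I : set A) (r : nat) : set A :=
  if r is r'.+1 then ideal_mul I (ideal_exp I r') else setT.

(* The largest r with f in I ^ r; None stands for infinity, the order of 0. *)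
Definition order_along (I : set A) (f : A) : option nat :=
  if f == 0 then None
  else Some (xget 0%N [set r | ideal_exp I r f /\
                               forall k, ideal_exp I k f -> (k <= r)%N]).

Definition leq_order (n : nat) (v : option nat) : bool :=
  if v is Some r then (n <= r)%N else true.

(* For the summands below, which are R-submodules of R[z], these are the
   submodule J p and the sum of a finite family of submodules. *)
Definition scale_set (J : set A) (p : {poly A}) : set {poly A} :=
  [set g *: p | g in J].

Definition sum_sets (n : nat) (B : 'I_n -> set {poly A}) : set {poly A} :=
  [set f | exists2 u : 'I_n -> {poly A},
     (forall s, B s (u s)) & f = \sum_(s < n) u s].

Definition poly_deg_le (l : nat) : set {poly A} := [set f | (size f <= l.+1)%N].
End Ideals.

(* An element of {poly {poly F}} is a polynomial in Y over F[X]: the outer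
   indeterminate is Y, the inner one is X. *)
Definition hermitian_poly (F : finFieldType) (q : nat) : {poly {poly F}} :=
  'X^q + 'X - ('X^(q.+1))%:P.

(* F[X,Y] / <Y^q + Y - X^(q+1)>; the library's quotient is by the given
   polynomial as soon as it is monic and nonconstant in Y, see
   mk_monic_hermitian. *)
Notation hermitian_ring F q := {poly %/ hermitian_poly F q}.

Definition on_hermitian (F : finFieldType) (q : nat) (P : F * F) : bool :=
  P.2 ^+ q + P.2 - P.1 ^+ q.+1 == 0.

(* The rational points, used directly as the index set of P_1, ..., P_n. *)
Notation hermitian_point F q := {P : F * F | on_hermitian q P}.

Lemma mk_monic_hermitian (F : finFieldType) (q : nat) :
  (1 < q)%N -> mk_monic (hermitian_poly F q) = hermitian_poly F q.
Proof.
move=> q1; rewrite /mk_monic /hermitian_poly -addrA.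
have hs : (size ('X - ('X^(q.+1))%:P : {poly {poly F}})%R
            < size ('X^q : {poly {poly F}})%R)%N.
  by rewrite size_XsubC size_polyXn ltnS.
rewrite size_polyDl // size_polyXn ltnS (ltnW q1) /=.
by rewrite monicE lead_coefDl // lead_coefXn eqxx.
Qed.

Section Curve.
Variables (F : finFieldType) (q : nat).
Local Notation R := (hermitian_ring F q).
Local Notation point := (hermitian_point F q).

Definition eval_curve (P : point) (f : R) : F :=
  (val f).[(val P).2%:P].[(val P).1].

(* The value of f at P does not depend on the representative of f. *)
Lemma eval_curve_in_qpoly (P : point) (p : {poly {poly F}}) :
  (1 < q)%N ->
  eval_curve P (in_qpoly (hermitian_poly F q) p)
    = p.[(val P).2%:P].[(val P).1].
Proof.
move=> q1; rewrite /eval_curve.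
have hm : hermitian_poly F q \is monic.
  by rewrite -(mk_monic_hermitian F q1) monic_mk_monic.
rewrite /= (mk_monic_hermitian F q1).
rewrite [in RHS](Pdiv.RingMonic.rdivp_eq hm p) hornerD hornerM hornerD hornerM.
case: P => -[a b] /= /eqP /= hP.
have -> : (hermitian_poly F q).[b%:P].[a] = 0.
  by rewrite /hermitian_poly !hornerE.
by rewrite mulr0 add0r.
Qed.

Definition eval_prod (P : point) (c : F) (f : {poly R}) : F :=
  (map_poly (eval_curve P) f).[c].

Definition maxideal_curve (P : point) : set R := [set f | eval_curve P f = 0].

Definition maxideal_prod (P : point) (c : F) : set {poly R} :=
  [set f | eval_prod P c f = 0].

Definition valuation (P : point) (f : R) : option nat :=
  order_along (maxideal_curve P) f.

Definition multiplicity (P : point) (c : F) (f : {poly R}) : option nat :=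
  order_along (maxideal_prod P c) f.

Definition ideal_I (m : point -> F -> nat) : set {poly R} :=
  [set f | forall P c, leq_order (m P c) (multiplicity P c f)].

Definition module_I (m : point -> F -> nat) (l : nat) : set {poly R} :=
  ideal_I m `&` poly_deg_le l.

Definition ideal_J (n : point -> nat) : set R :=
  [set f | forall P, leq_order (n P) (valuation P f)].

Definition max_mult (m : point -> F -> nat) (P : point) : nat :=
  \max_(c : F) m P c.

Definition lmax (m : point -> F -> nat) : nat :=
  \max_(P : point) \sum_(c : F) m P c.

(* ms, gam, h record a run of the inductive construction started at m: the
   lists m^(s), the chosen field elements gamma_i at stage s (only relevant at
   points with n_i^(s) > 0) and the chosen functions h^(s).  Nothing is imposed
   on gam and h at stages s >= lmax m, nor on ms at stages s > lmax m. *)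
Record construction (m : point -> F -> nat) (ms : nat -> point -> F -> nat)
    (gam : nat -> point -> F) (h : nat -> R) : Prop := Construction {
  construction_init : forall P c, ms 0%N P c = m P c;
  construction_gam : forall s P, (s < lmax m)%N -> (0 < max_mult (ms s) P)%N ->
    ms s P (gam s P) = max_mult (ms s) P;
  construction_h : forall s P, (s < lmax m)%N -> (0 < max_mult (ms s) P)%N ->
    eval_curve P (h s) = gam s P;
  construction_step : forall s P c, (s < lmax m)%N ->
    ms s.+1 P c = if (0 < max_mult (ms s) P)%N && (c == gam s P)
                  then (ms s P c).-1 else ms s P c }.

(* J_{N^(s)} and h^(s), with the conventions J_{N^(s)} = R and h^(s) = 0 for
   s >= lmax. *)
Definition stage_J (m : point -> F -> nat) (ms : nat -> point -> F -> nat)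
    (s : nat) : set R :=
  if (s < lmax m)%N then ideal_J (max_mult (ms s)) else setT.

Definition stage_h (m : point -> F -> nat) (h : nat -> R) (s : nat) : R :=
  if (s < lmax m)%N then h s else 0.
End Curve.

(* Main.v *)
(* Dividing f in I_M by z - h leaves the remainder f(h), which lies in J_N because
   z = h maps the maximal ideal at (P_i, gamma_i) into the one at P_i; the quotient
   lies in I_M', where M' lowers the multiplicities at the points (P_i, gamma_i) by
   one.  Hence I_M = J_N + (z - h) I_M', and induction on the degree applies.  Since
   the maximal column sum of M drops at each step, M^(lmax) = 0.

   For the largest exponents r with f in m^r to exist one needs the powers of m_P to
   have zero intersection in R.  Y^q + Y - X^(q+1) is coprime over F(X) to every
   nonzero polynomial of smaller degree in Y, by giving X and Y the coprime weights
   q and q + 1, so a nonzero f in R has a nonzero multiple in F[x].  Expanding y as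
   a power series in x - a at P = (a, b) bounds r by the degree of that multiple. *)
Require Import Defs.
From HB Require Import structures.
From mathcomp Require Import all_boot all_algebra all_field zify ring.
From mathcomp Require Import classical_sets boolp.

Set Implicit Arguments.
Unset Strict Implicit.
Unset Printing Implicit Defensive.

Import GRing.Theory Pdiv.Idomain.

Local Open Scope ring_scope.

(** * Powers of an ideal and the order along it *)

Section IdealPowers.
Variable A : comNzRingType.
Implicit Types (I : set A) (f g : A).

(** Elements of a power are finite sums of products, so a property closed under sums need only be
    checked on single products. *)
Lemma ideal_exp_ind I r (Q : A -> Prop) :
    Q 0 -> (forall f g, Q f -> Q g -> Q (f + g)) ->
    (forall f g, I f -> ideal_exp I r g -> Q (f * g)) ->
  forall f, ideal_exp I r.+1 f -> Q f.
Proof.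
move=> Q0 QD QM f [s [sI ->]]; elim: s sI => [|u s IHs] sI.
  by rewrite big_nil.
rewrite big_cons; apply: QD; last by apply: IHs => v vs; apply: sI; rewrite inE vs orbT.
by have [] := sI u (mem_head _ _); apply: QM.
Qed.

Lemma ideal_expS I r f g : I f -> ideal_exp I r g -> ideal_exp I r.+1 (f * g).
Proof.
by move=> If Ig; exists [:: (f, g)]; split=> [u|]; rewrite ?big_seq1 // inE => /eqP ->.
Qed.

Lemma ideal_exp0 I r : ideal_exp I r 0.
Proof. by case: r => // r; exists [::]; rewrite big_nil. Qed.

Lemma ideal_expD I r f g :
  ideal_exp I r f -> ideal_exp I r g -> ideal_exp I r (f + g).
Proof.
case: r => // r [s [sI ->]] [t [tI ->]]; exists (s ++ t); rewrite big_cat.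
by split=> // u; rewrite mem_cat => /orP[/sI|/tI].
Qed.

Lemma ideal_exp_sum I r (T : Type) (s : seq T) (P : pred T) (G : T -> A) :
  (forall i, P i -> ideal_exp I r (G i)) -> ideal_exp I r (\sum_(i <- s | P i) G i).
Proof.
by move=> GI; apply: big_ind => //; [apply: ideal_exp0 | apply: ideal_expD].
Qed.

Lemma ideal_expMl I r f g : ideal_exp I r g -> ideal_exp I r (f * g).
Proof.
elim: r f g => // r IHr f; apply: ideal_exp_ind => [|g h fg fh|g h Ig Ih].
- by rewrite mulr0; apply: ideal_exp0.
- by rewrite mulrDr; apply: ideal_expD.
- by rewrite mulrCA; apply: ideal_expS => //; apply: IHr.
Qed.

Lemma ideal_expB I r f g :
  ideal_exp I r f -> ideal_exp I r g -> ideal_exp I r (f - g).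
Proof. by move=> fI gI; rewrite -mulN1r; apply/ideal_expD/ideal_expMl. Qed.

Lemma ideal_exp_le I r k f : (k <= r)%N -> ideal_exp I r f -> ideal_exp I k f.
Proof.
elim: r f => [|r IHr] f; first by rewrite leqn0 => /eqP ->.
rewrite leq_eqVlt => /predU1P[-> //|kr]; apply: ideal_exp_ind.
- exact: ideal_exp0.
- by move=> *; apply: ideal_expD.
- by move=> u v _ vI; apply/ideal_expMl/IHr.
Qed.

Lemma ideal_expM I r k f g :
  ideal_exp I r f -> ideal_exp I k g -> ideal_exp I (r + k) (f * g).
Proof.
elim: r f => [|r IHr] f fI gI; first exact: ideal_expMl.
elim/ideal_exp_ind: fI => [|u v uI vI|u v uI vI].
- by rewrite mul0r; apply: ideal_exp0.
- by rewrite mulrDl; apply: ideal_expD.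
- by rewrite -mulrA addSn; apply/ideal_expS/IHr.
Qed.

Lemma ideal_expX I r f : I f -> ideal_exp I r (f ^+ r).
Proof. by move=> If; elim: r => // r IHr; rewrite exprS; apply: ideal_expS. Qed.

(* [xget] returns the junk value 0 when no largest exponent exists, whence the
   boundedness assumption. *)
Lemma leq_orderE I f r :
    (f != 0 -> exists b, forall k, ideal_exp I k f -> (k <= b)%N) ->
  leq_order r (order_along I f) <-> ideal_exp I r f.
Proof.
rewrite /order_along; have [-> _|f0 /(_ isT)[b fb]] := eqVneq f 0.
  by split=> // _; apply: ideal_exp0.
have ex0 : exists k, `[< ideal_exp I k f >] by exists 0%N; apply/asboolP.
have exb k : `[< ideal_exp I k f >] -> (k <= b)%N by move/asboolP/fb.
have [k /asboolP kf kmax] := ex_maxnP ex0 exb.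
have -> : xget 0%N [set s | ideal_exp I s f /\
    forall k, ideal_exp I k f -> (k <= s)%N]%classic = k.
  case: xgetP => [s _ /= [sf smax]|/(_ k)[]]; last first.
    by split=> // s /asboolP/kmax.
  by apply/eqP; rewrite eqn_leq smax // andbT; apply/kmax/asboolP.
by split=> [rk|rf]; [apply: ideal_exp_le kf | apply/kmax/asboolP].
Qed.

End IdealPowers.

Lemma ideal_exp_rmorph (A B : comNzRingType) (phi : {rmorphism A -> B})
    (I : set A) (J : set B) r f :
  (forall g, I g -> J (phi g)) -> ideal_exp I r f -> ideal_exp J r (phi f).
Proof.
move=> IJ; elim: r f => // r IHr f fI.
elim/ideal_exp_ind: fI => [|g h|g h gI hI].
- by rewrite rmorph0; apply: ideal_exp0.
- by rewrite rmorphD; apply: ideal_expD.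
- by rewrite rmorphM; apply: ideal_expS; [apply: IJ | apply: IHr].
Qed.

(** * Maximal ideals of points on the product with the affine line *)

Section PolynomialFibre.
Variables (A : comNzRingType) (K : fieldType) (ev : {rmorphism A -> K}).
Variables (cst : K -> A) (cstK : cancel cst ev).
Implicit Types (f g h : A) (p : {poly A}).

Definition fibre_ideal : set A := fun f => ev f = 0.
Definition point_ideal (c : K) : set {poly A} := fun p => (map_poly ev p).[c] = 0.

(* Together with [coef_point_ideal_exp]: after translating [h] to 0, the powers of
   [(m, X)] are the polynomials whose i-th coefficient lies in [m ^ (r - i)]. *)
Lemma point_ideal_exp_coef c h r p i : ev h = c ->
  ideal_exp (point_ideal c) r p ->
  ideal_exp fibre_ideal (r - i) (p \Po ('X + h%:P))`_i.
Proof.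
move=> hc; elim: r p i => // r IHr p i pI; move: p pI i.
apply: ideal_exp_ind => [i|u v uI vI i|u v uI vI i].
- by rewrite comp_poly0 coef0; apply: ideal_exp0.
- by rewrite comp_polyD coefD; apply: ideal_expD.
rewrite comp_polyM coefM; apply: ideal_exp_sum => -[[|j] ji] _ /=; last first.
  (* Taking a coefficient of positive index from [u] lowers the index in [v], which already supplies
     the extra exponent. *)
  apply/ideal_expMl/(ideal_exp_le _ (IHr _ _ vI)).
  by lia.
(* The constant coefficient is [u.[h]], which [ev] sends to the value of [u] at [c]. *)
rewrite subn0; have uI0 : fibre_ideal (u \Po ('X + h%:P))`_0.
  rewrite -horner_coef0 horner_comp !hornerE /fibre_ideal /=.
  by rewrite -horner_map hc.
apply: (@ideal_exp_le _ _ (r - i).+1); first by lia.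
by apply/ideal_expS/IHr.
Qed.

Lemma XsubC_point_ideal h : point_ideal (ev h) ('X - h%:P).
Proof. by rewrite /point_ideal rmorphB /= map_polyX map_polyC !hornerE subrr. Qed.

Lemma polyC_point_ideal c r f :
  ideal_exp fibre_ideal r f -> ideal_exp (point_ideal c) r f%:P.
Proof.
apply: (ideal_exp_rmorph (phi := polyC)) => g gI.
by rewrite /point_ideal map_polyC hornerC.
Qed.

Lemma coef_point_ideal_exp h r p :
    (forall i, ideal_exp fibre_ideal (r - i) (p \Po ('X + h%:P))`_i) ->
  ideal_exp (point_ideal (ev h)) r p.
Proof.
move=> pI; rewrite -(comp_polyXaddC_K p h) comp_polyE.
apply: ideal_exp_sum => i _; rewrite -mul_polyC.
apply: (@ideal_exp_le _ _ (r - i + i)); first by lia.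
apply: ideal_expM; first exact: polyC_point_ideal.
by apply/ideal_expX/XsubC_point_ideal.
Qed.

Lemma horner_point_ideal_exp h r p :
  ideal_exp (point_ideal (ev h)) r p -> ideal_exp fibre_ideal r p.[h].
Proof.
move=> /(point_ideal_exp_coef 0 (erefl _)); rewrite subn0 -horner_coef0.
by rewrite horner_comp !hornerE.
Qed.

(** Once [h] is translated to 0, dividing by [X - h] shifts the coefficients down by one index,
    which costs one exponent. *)
Lemma point_ideal_exp_divX h r p :
  ideal_exp (point_ideal (ev h)) r (('X - h%:P) * p) ->
  ideal_exp (point_ideal (ev h)) r.-1 p.
Proof.
move=> pI; apply: coef_point_ideal_exp => i.
have := point_ideal_exp_coef i.+1 (erefl _) pI.
rewrite comp_polyM comp_polyB comp_polyX comp_polyC addrK coefXM /=.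
by rewrite -subn1 -subnDA add1n.
Qed.

(* [X - h] is invertible modulo the maximal ideal, hence modulo its powers. *)
Lemma point_ideal_exp_div_unit c h r p : ev h != c ->
  ideal_exp (point_ideal c) r (('X - h%:P) * p) -> ideal_exp (point_ideal c) r p.
Proof.
move=> hc pI; pose k := cst (ev h - c)^-1; pose v := 1 + k%:P * ('X - h%:P).
have vI : point_ideal c v.
  rewrite /point_ideal /v rmorphD rmorphM rmorphB rmorph1 /= !map_polyC map_polyX.
  rewrite !hornerE /= cstK -[c - _]opprB mulrN mulVf ?subrr //.
  by rewrite subr_eq0.
suff: forall s, (s <= r)%N -> ideal_exp (point_ideal c) s p by apply.
elim=> // s IHs sr; have -> : p = v * p - k%:P * (('X - h%:P) * p).
  by rewrite /v mulrDl mul1r -mulrA addrK.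
apply: ideal_expB; first by apply/ideal_expS/IHs/ltnW.
exact/ideal_expMl/ideal_exp_le/pI.
Qed.

(** The leading coefficient of the translate, of index d, lies in the power [k - d] of the fibre
    ideal, so its bound plus d bounds [k]. *)
Lemma point_ideal_bounded c p :
    (forall f, f != 0 -> exists b, forall k, ideal_exp fibre_ideal k f -> (k <= b)%N) ->
  p != 0 -> exists b, forall k, ideal_exp (point_ideal c) k p -> (k <= b)%N.
Proof.
move=> bnd p0; pose p' := p \Po ('X + (cst c)%:P).
have p'0 : p' != 0.
  apply: contra_neq p0 => p'0.
  by rewrite -(comp_polyXaddC_K p (cst c)) -/p' p'0 comp_poly0.
have [|b pb] := bnd (lead_coef p'); first by rewrite lead_coef_eq0.
exists (b + (size p').-1)%N => k /(point_ideal_exp_coef (size p').-1 (cstK c)).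
by move/pb; rewrite leq_subLR addnC.
Qed.

End PolynomialFibre.

(** * Decomposition by repeated division by [z - h] *)

Section Decomposition.
Variables (A : comNzRingType) (K : fieldType) (T : Type).
Variables (ev : T -> {rmorphism A -> K}) (cst : K -> A).
Hypothesis cstK : forall P, cancel cst (ev P).

Definition fat_ideal (n : T -> nat) : set A :=
  fun f => forall P, ideal_exp (fibre_ideal (ev P)) (n P) f.
Definition fat_point_ideal (M : T -> K -> nat) : set {poly A} :=
  fun p => forall P c, ideal_exp (point_ideal (ev P) c) (M P c) p.

Definition reduction (n : T -> nat) (gam : T -> K) (h : A)
    (M M' : T -> K -> nat) : Prop :=
  forall P, [/\ forall c, (M P c <= n P)%N,
    (0 < n P)%N -> M P (gam P) = n P /\ ev P h = gam P &
    forall c, M' P c =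
      if (0 < n P)%N && (c == gam P) then (M P c).-1 else M P c].

Lemma reduction_sub n gam h M M' f p : reduction n gam h M M' ->
    fat_ideal n f -> fat_point_ideal M' p ->
  fat_point_ideal M (f%:P + ('X - h%:P) * p).
Proof.
move=> red fJ pI P c; have [Mn Mg M'E] := red P.
apply: ideal_expD; first by apply: ideal_exp_le (polyC_point_ideal c (fJ P)).
have := pI P c; rewrite M'E; have [nP /=|] := boolP (0 < n P)%N; last first.
  by move=> _ /=; apply: ideal_expMl.
have [_ hP] := Mg nP; case: eqVneq => [->|_]; last exact: ideal_expMl.
case: (M P _) => // k pk; apply: ideal_expS => //.
by rewrite -hP; apply: XsubC_point_ideal.
Qed.

Lemma reduction_division n gam h M M' p :
    reduction n gam h M M' -> fat_point_ideal M p ->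
  exists f k, [/\ fat_ideal n f, fat_point_ideal M' k,
    p = f%:P + ('X - h%:P) * k & (size k <= (size p).-1)%N].
Proof.
move=> red pI; exists p.[h].
have /factor_theorem[k pk]: root (p - p.[h]%:P) h by rewrite rootE !hornerE subrr.
have pE : p = p.[h]%:P + ('X - h%:P) * k by rewrite mulrC -pk addrC subrK.
have fJ : fat_ideal n p.[h].
  move=> P; have [Mn Mg _] := red P; have [n0|nP] := posnP (n P); first by rewrite n0.
  by have [Mgn hP] := Mg nP; apply: horner_point_ideal_exp; rewrite hP -Mgn.
exists k; split=> //; last first.
  have [->|k0] := eqVneq k 0; first by rewrite size_poly0.
  have: (size (p - p.[h]%:P)%R <= maxn (size p) 1)%N.
    rewrite (leq_trans (size_polyD _ _)) // size_polyN geq_max leq_maxl /=.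
    by rewrite (leq_trans (size_polyC_leq1 _)) // leq_maxr.
  rewrite pk size_Mmonic ?monicXsubC // size_XsubC.
  by move: k0; rewrite -size_poly_gt0; lia.
move=> P c; have [Mn Mg ->] := red P.
have hkI : ideal_exp (point_ideal (ev P) c) (M P c) (('X - h%:P) * k).
  have -> : ('X - h%:P) * k = p - p.[h]%:P by rewrite mulrC -pk.
  by apply: ideal_expB => //; apply: ideal_exp_le (polyC_point_ideal c (fJ P)).
have [nP|] := boolP (0 < n P)%N; last first.
  by rewrite -eqn0Ngt => /eqP n0 /=; move: (Mn c); rewrite n0 leqn0 => /eqP ->.
have [_ hP] := Mg nP; case: eqVneq => [cg|cg] /=.
  (* Division costs one exponent at the chosen point only; over the other values of [z] the divisor
     is locally a unit. *)
  by move: hkI; rewrite cg -hP; apply: point_ideal_exp_divX.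
by apply: (point_ideal_exp_div_unit (cstK P) _ hkI); rewrite hP eq_sym.
Qed.

(** Induction on [l] for all infinite sequences of reductions at once: the quotient of the first
    division is decomposed along the shifted sequences. *)
Lemma reduction_decomposition (l : nat) (n : nat -> T -> nat) (gam : nat -> T -> K)
    (h : nat -> A) (M : nat -> T -> K -> nat) (p : {poly A}) :
    (forall s, reduction (n s) (gam s) (h s) (M s) (M s.+1)) ->
  fat_point_ideal (M 0%N) p /\ (size p <= l.+1)%N <->
  exists2 f : nat -> A, forall s, fat_ideal (n s) (f s) &
    p = \sum_(s < l.+1) f s *: \prod_(r < s) ('X - (h r)%:P).
Proof.
elim: l n gam h M p => [|l IHl] n gam h M p red; split.
- move=> [pI pl]; have [f [k [fJ _ pE kl]]] := reduction_division (red 0%N) pI.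
  exists (fun s => if s is 0 then f else 0).
    by case=> // s P; apply: ideal_exp0.
  rewrite big_ord1 big_ord0 alg_polyC pE.
  have /eqP -> : k == 0 by rewrite -size_poly_leq0; lia.
  by rewrite mulr0 addr0.
- move=> [f fJ ->]; rewrite big_ord1 big_ord0 alg_polyC; split.
    have -> : (f 0%N)%:P = (f 0%N)%:P + ('X - (h 0%N)%:P) * 0 by rewrite mulr0 addr0.
    apply: (reduction_sub (red 0%N)) => // P c; exact: ideal_exp0.
  exact: size_polyC_leq1.
- move=> [pI pl]; have [f [k [fJ kI pE kl]]] := reduction_division (red 0%N) pI.
  have [|g gJ kE] := (IHl _ _ _ _ k (fun s => red s.+1)).1; first by split=> //; lia.
  exists (fun s => if s is s'.+1 then g s' else f); first by case.
  rewrite big_ord_recl big_ord0 alg_polyC pE kE mulr_sumr; congr (_ + _).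
  by apply: eq_bigr => s _; rewrite big_ord_recl /= -scalerAr.
- move=> [f fJ ->]; rewrite big_ord_recl big_ord0 alg_polyC.
  pose k := \sum_(s < l.+1) f s.+1 *: \prod_(r < s) ('X - (h r.+1)%:P).
  have [|kI kl] := (IHl _ _ _ _ k (fun s => red s.+1)).2.
    by exists (fun s => f s.+1).
  have -> : \sum_(s < l.+1) f (lift ord0 s) *: \prod_(r < lift ord0 s) ('X - (h r)%:P)
      = ('X - (h 0%N)%:P) * k.
    rewrite mulr_sumr; apply: eq_bigr => s _.
    by rewrite big_ord_recl /= -scalerAr.
  split; first exact: reduction_sub (red 0%N) _ _.
  rewrite (leq_trans (size_polyD _ _)) // geq_max.
  rewrite (leq_trans (size_polyC_leq1 _)) //=.
  rewrite (leq_trans (size_polyMleq _ _)) // size_XsubC; lia.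
Qed.

End Decomposition.

(** * Weighted degree with weights [q] for X and [q + 1] for Y *)

Section WeightedDegree.
Variables (F : fieldType) (q : nat).
Implicit Types (D : {poly {poly F}}).

(* The substitution X = T^q, Y = T^(q+1) U, with T the outer and U the inner
   indeterminate of the target; the weighted degree is the degree in T. *)
Let weighted_coef : {rmorphism {poly F} -> {poly {poly F}}} :=
  comp_poly 'X^q \o map_poly polyC.
Let weighted_rmorph : {rmorphism {poly {poly F}} -> {poly {poly F}}} :=
  horner_eval ('X^(q.+1) * 'X%:P) \o map_poly weighted_coef.
Definition weighted_poly D : {poly {poly F}} := weighted_rmorph D.

Lemma weighted_polyD D E : weighted_poly (D + E) = weighted_poly D + weighted_poly E.
Proof. exact: (rmorphD weighted_rmorph). Qed.

Lemma weighted_polyM D E : weighted_poly (D * E) = weighted_poly D * weighted_poly E.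
Proof. exact: (rmorphM weighted_rmorph). Qed.

Lemma weighted_polyC (c : {poly F}) : weighted_poly c%:P = c^:P \Po 'X^q.
Proof.
by rewrite /weighted_poly /weighted_rmorph /= map_polyC /horner_eval hornerC.
Qed.

Lemma weighted_polyX : weighted_poly 'X = 'X^(q.+1) * 'X%:P.
Proof.
by rewrite /weighted_poly /weighted_rmorph /= map_polyX /horner_eval hornerX.
Qed.

Lemma weighted_polyXn k : weighted_poly 'X^k = ('X^(q.+1) * 'X%:P) ^+ k.
Proof. by rewrite -weighted_polyX; apply: (rmorphXn weighted_rmorph). Qed.

Lemma weighted_poly_sum (n : nat) (E : 'I_n -> {poly {poly F}}) :
  weighted_poly (\sum_i E i) = \sum_i weighted_poly (E i).
Proof. exact: (rmorph_sum weighted_rmorph). Qed.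

Hypothesis q_gt1 : (1 < q)%N.

(** [X^a Y^i] becomes [T^(q a + (q + 1) i) U^i], so for given [k] and [i] at most one exponent [a]
    contributes. *)
Lemma coef_weighted_poly D k :
  (weighted_poly D)`_k = \sum_(i < size D)
    (if (q.+1 * i <= k)%N && (q %| k - q.+1 * i)%N
     then (D`_i)`_((k - q.+1 * i) %/ q) *: 'X^i else 0).
Proof.
rewrite -{1}[D]coefK poly_def weighted_poly_sum coef_sum; apply: eq_bigr => i _.
rewrite -mul_polyC weighted_polyM weighted_polyC weighted_polyXn exprMn -exprM.
rewrite -rmorphXn /= mulrA coefMC coefMXn.
rewrite ltnNge; case: leqP => //= _; last by rewrite mul0r.
rewrite coef_comp_poly_Xn ?(ltnW q_gt1) //.
by case: ifP; rewrite ?mul0r // coef_map mul_polyC.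
Qed.

(* The weights [q * deg D_i + (q + 1) * i] with [i < q] are distinct modulo [q],
   so the part of maximal weight is a single monomial [a X^k Y^i], which becomes
   [a U^i]. *)
Lemma lead_coef_weighted_poly D : D != 0 -> (size D <= q)%N ->
  (lead_coef (weighted_poly D)).[1] != 0.
Proof.
move=> D0 Dq; pose w (i : 'I_(size D)) := (q * (size (D`_i)%R).-1 + q.+1 * i)%N.
have D_gt0 : (0 < size D)%N by rewrite size_poly_gt0.
have D_last : D`_(Ordinal (eq_leq (prednK D_gt0)) : 'I_(size D)) != 0.
  by rewrite -[_ != 0]/(lead_coef D != 0) lead_coef_eq0.
have [i0 Di0 wmax] := @arg_maxnP _ _ (fun i : 'I_(size D) => D`_i != 0) w D_last.
have coefW : (weighted_poly D)`_(w i0) = lead_coef D`_i0 *: 'X^i0.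
  rewrite coef_weighted_poly (bigD1 i0) //= leq_addl addnK dvdn_mulr // mulKn; last by lia.
  rewrite big1 ?addr0 // => i ii0; case: ifP => // /andP[iw /dvdnP[k kE]].
  have /eqP[] := ii0; apply/val_inj/eqP => /=.
  rewrite -(modn_small (leq_trans (ltn_ord i) Dq)) -(modn_small (leq_trans (ltn_ord i0) Dq)).
  have wE : ((k + i) * q + i = ((size (D`_i0)%R).-1 + i0) * q + i0)%N.
    by move: kE iw; rewrite /w; nia.
  by have := congr1 (modn^~ q) wE; rewrite /= !modnMDl => ->.
have coef0 j : (w i0 < j)%N -> (weighted_poly D)`_j = 0.
  move=> wj; rewrite coef_weighted_poly big1 // => i _; case: ifP => // /andP[ij /dvdnP[k kE]].
  rewrite kE mulnK; last by lia.
  have [Di|Di] := eqVneq D`_i 0; first by rewrite Di coef0 scale0r.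
  have wi : (w i < q * k + q.+1 * i)%N.
    by rewrite (mulnC q) -kE subnK //; apply: leq_ltn_trans wj; apply: wmax.
  (* A weight above the maximum requires an X-exponent beyond the degree of the coefficient. *)
  rewrite nth_default ?scale0r //; move: wi.
  rewrite /w ltn_add2r ltn_pmul2l ?(ltnW q_gt1) //. by case: (size _).
have sz : size (weighted_poly D) = (w i0).+1.
  apply/eqP; rewrite eqn_leq; apply/andP; split.
    by apply/leq_sizeP => j /coef0.
  rewrite ltnNge; apply/negP => /leq_sizeP/(_ _ (leqnn _))/eqP.
  by rewrite coefW scaler_eq0 lead_coef_eq0 (negPf Di0) -size_poly_eq0 size_polyXn.
by rewrite lead_coefE sz coefW hornerZ hornerXn expr1n mulr1 lead_coef_eq0.
Qed.
End WeightedDegree.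

(** * Bounded orders on the Hermitian curve *)

Section HermitianRing.
Variables (F : finFieldType) (q : nat).
Hypothesis q_gt1 : (1 < q)%N.
Local Notation H := (hermitian_poly F q).
Local Notation R := (hermitian_ring F q).
Implicit Types (P : hermitian_point F q) (f g : R) (c : {poly F}) (D : {poly {poly F}}).

(* The part of maximal weight of [H] is [Y^q - X^(q+1)], which becomes [U^q - 1]. *)
Lemma lead_coef_weighted_hermitian : (lead_coef (weighted_poly q H)).[1] = 0.
Proof.
have q_gt0 : (0 < q)%N by apply: ltnW.
have -> : weighted_poly q H = ('X^q - 1)%:P * 'X^(q.+1 * q) + 'X%:P * 'X^(q.+1).
  have XE : (- 'X^(q.+1) : {poly F})^:P \Po 'X^q = - 'X^(q.+1 * q).
    by rewrite raddfN /= map_polyXn raddfN /= comp_Xn_poly -exprM mulnC.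
  rewrite /hermitian_poly -polyCN !weighted_polyD weighted_polyXn weighted_polyX.
  rewrite weighted_polyC XE exprMn -exprM -rmorphXn rmorphB rmorph1 /=; ring.
have nz : ('X^q - 1 : {poly F}) != 0 by rewrite -size_poly_gt0 size_XnsubC.
rewrite lead_coefDl; last first.
  rewrite !size_Cmul ?polyX_eq0 // !size_polyXn ltnS; nia.
by rewrite lead_coefM lead_coefC lead_coefXn !hornerE expr1n subrr.
Qed.

Lemma size_hermitian : size H = q.+1.
Proof.
rewrite /hermitian_poly -addrA size_polyDl size_polyXn //.
by rewrite size_XsubC ltnS.
Qed.

(* A factor of [H] of [Y]-degree less than [q] would have a cofactor of the same
   kind; by weights neither vanishes at [U = 1], unlike [H]. *)
Lemma hermitian_coprime D :
  D != 0 -> (size D <= q)%N -> (size (gcdp D H) <= 1)%N.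
Proof.
move=> D0 Dq; rewrite leqNgt; apply/negP => gcd1.
have gq : (size (gcdp D H) <= q)%N by rewrite (leq_trans _ Dq) // dvdp_leq // dvdp_gcdl.
(* Divisibility over [F[X]] is up to a nonzero factor [c], as over F(X). *)
have [c [E [c0 cE]]] : exists c (E : {poly {poly F}}), c != 0 /\ c *: H = E * gcdp D H.
  by have /dvdpP[[c E] /= c0 cE] := dvdp_gcdr D H; exists c, E.
have H0 : H != 0 by rewrite -size_poly_eq0 size_hermitian.
have g0 : gcdp D H != 0 by rewrite -size_poly_gt0 ltnW.
have E0 : E != 0.
  apply: contra_neq c0 => E0; apply/eqP; move/eqP: cE.
  by rewrite E0 mul0r -mul_polyC mulf_eq0 polyC_eq0 (negPf H0) orbF.
have Eq : (size E <= q)%N.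
  have := congr1 (size \o polyseq) cE; rewrite /= size_scale // size_hermitian size_mul //.
  move: gcd1; case: (size (gcdp D H)) => [|[|k]] //= _.
  by rewrite !addnS /= => -[->]; apply: leq_addr.
have lcM (a b d e : {poly {poly F}}) : a * b = d * e -> (lead_coef b).[1] = 0 ->
    (lead_coef d).[1] != 0 -> (lead_coef e).[1] != 0 -> False.
  move=> /(congr1 (fun p : {poly {poly F}} => (lead_coef p).[1])).
  rewrite !lead_coefM !hornerM => + b0 d0 e0; rewrite b0 mulr0 => /esym/eqP.
  by apply/negP/mulf_neq0.
have wE : weighted_poly q c%:P * weighted_poly q H
    = weighted_poly q E * weighted_poly q (gcdp D H).
  by rewrite -2!weighted_polyM -cE -mul_polyC.
apply: lcM wE lead_coef_weighted_hermitian _ _; exact: lead_coef_weighted_poly.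
Qed.

(** The resultant in Y lies in the ideal of [D] and [H] and is nonzero by coprimality; a [D]
    constant in Y serves itself. *)
Lemma hermitian_elimination D : D != 0 -> (size D <= q)%N ->
  exists c E E', c != 0 /\ c%:P = E * D + E' * H.
Proof.
move=> D0 Dq; have [D1|D1] := leqP (size D) 1.
  have DE := size1_polyC D1.
  exists D`_0, 1, 0; rewrite mul1r mul0r addr0 -DE; split=> //.
  by apply: contra_neq D0 => c0; rewrite DE c0.
have [|[E E'] _ cE] := resultant_in_ideal D1 (_ : (1 < size H)%N).
  by rewrite size_hermitian ltnS ltnW.
exists (resultant D H), E, E'; split=> //.
by rewrite resultant_eq0 -leqNgt hermitian_coprime.
Qed.

Hypothesis q_pchar : [pchar F].-nat q.

(* If [y' = x^(q+1) - y^q] then [H(y') = (- H(y))^q], so the iteration converges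
   [x - a]-adically to the branch of the curve at [P]. *)
Lemma hermitian_local_solution P r : exists y : {poly F},
  y.[(val P).1] = (val P).2 /\ ('X - (val P).1%:P) ^+ r %| H.[y].
Proof.
case: P => -[a b] /=; rewrite /on_hermitian /= => /eqP Pab.
have HE y : H.[y] = y ^+ q + y - 'X^(q.+1) by rewrite /hermitian_poly !hornerE.
(* The exponent starts at 1, since multiplying it by [q] gains nothing at 0. *)
suff: exists y : {poly F}, y.[a] = b /\ ('X - a%:P) ^+ r.+1 %| H.[y].
  move=> [y [ya yr]]; exists y; split=> //; apply: dvdp_trans yr.
  by rewrite dvdp_exp2l.
elim: r => [|r [y [ya yr]]].
  exists b%:P; rewrite hornerC expr1; split=> //.
  by rewrite HE dvdp_XsubCl rootE !hornerE; apply/eqP.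
exists ('X^(q.+1) - y ^+ q); split.
  by rewrite !hornerE ya -[RHS]subr0 -Pab; ring.
have -> : H.['X^(q.+1) - y ^+ q] = (- H.[y]) ^+ q.
  have yE : 'X^(q.+1) - y ^+ q = y + - H.[y] by rewrite HE; ring.
  have : [pchar {poly F}].-nat q by rewrite (eq_pnat _ (pchar_poly F)).
  rewrite [LHS]HE [in X in X ^+ q]yE => /exprDn_pchar ->; ring.
apply: (@dvdp_trans _ (('X - a%:P) ^+ (r.+1 * q))); first by apply: dvdp_exp2l; nia.
by rewrite exprM; apply: dvdp_exp2r; rewrite dvdpNr.
Qed.

Lemma val_hermitianM f g : exists D, val (f * g) = val f * val g - D * H.
Proof.
have Hm : H \is monic by rewrite -(mk_monic_hermitian F q_gt1) monic_mk_monic.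
have rmodE D : Pdiv.CommonRing.rmodp D (mk_monic H) = D - Pdiv.CommonRing.rdivp D H * H.
  apply/eqP; rewrite (mk_monic_hermitian F q_gt1) eq_sym subr_eq addrC; apply/eqP.
  exact: Pdiv.RingMonic.rdivp_eq.
by exists (Pdiv.CommonRing.rdivp (val f * val g) H); apply: rmodE.
Qed.

(** Substituting [y] for Y is multiplicative only up to multiples of [H.[y]]; these are divisible by
    the power [r] of [x - a], whence [k <= r]. *)
Lemma maxideal_exp_dvdp P r f y :
    y.[(val P).1] = (val P).2 -> ('X - (val P).1%:P) ^+ r %| H.[y] ->
  forall k, (k <= r)%N -> ideal_exp (maxideal_curve P) k f ->
  ('X - (val P).1%:P) ^+ k %| (val f).[y].
Proof.
move=> yP yr k; elim: k f => [|k IHk] f; first by rewrite expr0 dvd1p.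
move=> kr; move: f; apply: ideal_exp_ind => [|g h|g h gI hI].
- by rewrite horner0 dvdp0.
- by rewrite hornerD; apply: dvdp_add.
have [D ->] := val_hermitianM g h; rewrite hornerD hornerN !hornerM.
rewrite dvdp_sub //; last exact/dvdp_mull/dvdp_trans/yr/dvdp_exp2l.
rewrite exprS dvdp_mul //; last by apply: IHk => //; apply: ltnW.
rewrite dvdp_XsubCl rootE; move/eqP: gI; rewrite /eval_curve.
set a := (val P).1; have ev z : (val g).[z].[a] = (map_poly (horner_eval a) (val g)).[z.[a]].
  exact: esym (horner_map (horner_eval a) _ _).
by rewrite !ev hornerC yP.
Qed.

(* Eliminating [Y] between [f] and [H] gives a nonzero multiple of [f] in [F[X]];
   on the branch at [P] its order at [a] is at least the exponent of [f]. *)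
Lemma maxideal_bounded P f : f != 0 ->
  exists b, forall k, ideal_exp (maxideal_curve P) k f -> (k <= b)%N.
Proof.
move=> f0; have vf0 : val f != 0 by [].
have fq : (size (val f) < q.+1)%N.
  apply: (leq_trans (size_mk_monic f)).
  by rewrite mk_monic_hermitian // size_hermitian.
have [c [E [E' [c0 cE]]]] := hermitian_elimination vf0 fq.
exists (size c) => k fk; have [y [yP yk]] := hermitian_local_solution P k.
have : ('X - (val P).1%:P) ^+ k %| c.
  rewrite -[c](hornerC c y) cE hornerD !hornerM dvdp_add // dvdp_mull //.
  exact: maxideal_exp_dvdp yP yk _ (leqnn k) fk.
by move=> /(dvdp_leq c0); rewrite size_exp_XsubC => /ltnW.
Qed.

Lemma eval_curve_rmorphism P : exists phi : {rmorphism R -> F}, phi =1 eval_curve P.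
Proof.
have evB : zmod_morphism (eval_curve P).
  by move=> f g; rewrite /eval_curve /= hornerD hornerN hornerD hornerN.
have evM : monoid_morphism (eval_curve P).
  split=> [|f g]; first by rewrite -(in_qpoly1 H) eval_curve_in_qpoly // !hornerC.
  have HP0 : H.[(val P).2%:P].[(val P).1] = 0.
    by rewrite /hermitian_poly !hornerE; apply/eqP: (valP P).
  rewrite /eval_curve; have [D ->] := val_hermitianM f g.
  by rewrite hornerD hornerN !hornerM hornerD hornerN !hornerM HP0 mulr0 subr0.
pose phiZ := GRing.isZmodMorphism.Build _ _ (eval_curve P) evB.
pose phiM := GRing.isMonoidMorphism.Build _ _ (eval_curve P) evM.
pose phi : {rmorphism R -> F} := HB.pack (eval_curve P) phiZ phiM.
by exists phi.
Qed.

End HermitianRing.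

(** * Termination of the inductive construction *)

Section Construction.
Variables (F : finFieldType) (q : nat).
Variables (m : hermitian_point F q -> F -> nat).
Variables (ms : nat -> hermitian_point F q -> F -> nat).
Variables (gam : nat -> hermitian_point F q -> F) (h : nat -> hermitian_ring F q).
Hypothesis hc : construction m ms gam h.

Lemma leq_max_mult (m' : hermitian_point F q -> F -> nat) P c :
  (m' P c <= max_mult m' P)%N.
Proof. exact: leq_bigmax. Qed.

(** Each step lowers a nonzero column sum by one and leaves a zero column zero. *)
Lemma construction_sum s P :
  (s <= lmax m)%N -> (\sum_(c : F) ms s P c <= lmax m - s)%N.
Proof.
elim: s => [_|s IHs sl].
  rewrite subn0 (eq_bigr (m P)) => [|c _]; last by rewrite (construction_init hc).
  exact: (@leq_bigmax _ (fun P => \sum_c m P c)%N).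
have stepE c := construction_step hc P c sl.
have [n0|nP] := posnP (max_mult (ms s) P).
  rewrite big1 // => c _; rewrite stepE n0 /=.
  by apply/eqP; rewrite -leqn0 -n0 leq_max_mult.
have := IHs (ltnW sl); rewrite (bigD1 (gam s P)) //= [in X in _ -> X](bigD1 (gam s P)) //=.
rewrite stepE nP eqxx /= (construction_gam hc) //.
rewrite [in X in _ -> X](eq_bigr (ms s P)) => [|c /negPf cg]; last by rewrite stepE cg andbF.
by move: (\sum_(_ | _) _)%N nP => k; lia.
Qed.

Lemma construction_end P c : ms (lmax m) P c = 0%N.
Proof.
have := construction_sum P (leqnn _); rewrite subnn leqn0 sum_nat_eq0.
by move=> /forallP/(_ c)/eqP.
Qed.

(** The record leaves [ms] free past [lmax m]; the zero list there yields [J = R] and keeps every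
    stage a [reduction]. *)
Definition stage_mult s : hermitian_point F q -> F -> nat :=
  if (s < lmax m)%N then ms s else fun _ _ => 0%N.

Lemma stage_multE s : (s <= lmax m)%N -> stage_mult s =2 ms s.
Proof.
rewrite /stage_mult leq_eqVlt => /predU1P[-> P c|-> //].
by rewrite ltnn construction_end.
Qed.

Lemma max_mult0 P : max_mult (fun (_ : hermitian_point F q) _ => 0%N) P = 0%N.
Proof. by rewrite /max_mult big1. Qed.

Lemma reduction_stage
    (ev : hermitian_point F q -> {rmorphism hermitian_ring F q -> F}) s :
    (forall P, ev P =1 eval_curve P) ->
  reduction ev (max_mult (stage_mult s)) (gam s) (stage_h m h s)
    (stage_mult s) (stage_mult s.+1).
Proof.
move=> evE P; split=> [c|nP|c]; first exact: leq_max_mult.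
  rewrite evE; move: nP; rewrite /stage_mult /stage_h; case: ifP => [sl nP|_].
    by rewrite (construction_gam hc) ?(construction_h hc).
  by rewrite max_mult0.
have [sl|sl] := ltnP s (lmax m).
  (* At [s.+1 = lmax m] this uses that the constructed list has become zero. *)
  rewrite stage_multE // (construction_step hc) //.
  by rewrite /stage_mult sl.
by rewrite /stage_mult !ltnNge sl leqW //= max_mult0.
Qed.

End Construction.

(** * Specialization to the Hermitian curve *)

Theorem corollary6 (F : finFieldType) (q : nat)
    (hq : prime_power q) (hF : #|F| = (q ^ 2)%N)
    (m : hermitian_point F q -> F -> nat)
    (ms : nat -> hermitian_point F q -> F -> nat)
    (gam : nat -> hermitian_point F q -> F)
    (h : nat -> hermitian_ring F q)
    (hc : construction m ms gam h) (l : nat) :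
  module_I m l =
    sum_sets (fun s : 'I_l.+1 =>
      scale_set (stage_J m ms s)
                (\prod_(r < s) ('X - (stage_h m h r)%:P))).
Proof.
have [p [k [p_prime k_gt0 qE]]] := hq.
have q_gt1 : (1 < q)%N.
  by rewrite qE -[1%N](expn0 p) ltn_exp2l ?prime_gt1.
have q_pchar : [pchar F].-nat q.
  have pF : p \in [pchar F].
    by apply: (@card_finPcharP _ _ (k * 2)%N) => //; rewrite hF qE expnM.
  by rewrite qE pnatX; apply/orP; left; rewrite pnatE.
have /boolp.choice[ev evE] : forall P : hermitian_point F q,
    exists phi : {rmorphism hermitian_ring F q -> F}, phi =1 eval_curve P.
  exact: eval_curve_rmorphism.
pose cst a := in_qpoly (hermitian_poly F q) a%:P%:P.
have cstK P : cancel cst (ev P).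
  by move=> a; rewrite evE eval_curve_in_qpoly // !hornerC.
have curveE P : maxideal_curve P = fibre_ideal (ev P).
  by apply/funext => f; rewrite /maxideal_curve /fibre_ideal evE.
have prodE P c : maxideal_prod P c = point_ideal (ev P) c.
  apply/funext => f; rewrite /maxideal_prod /point_ideal /eval_prod /=.
  by rewrite (eq_map_poly (evE P)).
have bnd P f : f != 0 -> exists b, forall k, ideal_exp (fibre_ideal (ev P)) k f -> (k <= b)%N.
  by rewrite -curveE; apply: maxideal_bounded.
have JE n f : ideal_J n f <-> fat_ideal ev n f.
  split=> fJ P; have := fJ P; rewrite /valuation curveE.
    by move/leq_orderE; apply=> /bnd.
  by move=> fI; apply/leq_orderE => // /bnd.
have IE M f : ideal_I M f <-> fat_point_ideal ev M f.
  split=> fI P c; have := fI P c; rewrite /multiplicity prodE.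
    by move/leq_orderE; apply=> f0; apply: point_ideal_bounded f0; [apply: cstK | apply: bnd].
  move=> fM; apply/leq_orderE => // f0.
  by apply: point_ideal_bounded f0; [apply: cstK | apply: bnd].
have stageE s f : stage_J m ms s f <-> fat_ideal ev (max_mult (stage_mult m ms s)) f.
  rewrite /stage_J /stage_mult; case: ifP => _; first exact: JE.
  by split=> // _ P; rewrite max_mult0.
have startE f : ideal_I m f <-> fat_point_ideal ev (stage_mult m ms 0) f.
  by rewrite IE; split=> fI P c; have := fI P c;
     rewrite (stage_multE hc) // (construction_init hc).
have red s := reduction_stage hc s evE.
have main f := reduction_decomposition cstK l f red.
apply/funext => f; apply/propext; split.
  move=> [/startE fI fl]; have [g gJ fE] := (main f).1 (conj fI fl).
  exists (fun s => g s *: \prod_(r < s) ('X - (stage_h m h r)%:P)) => // s.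
  by exists (g s) => //; apply/stageE.
move=> [u uJ ->].
have /boolp.choice[g gJ] : forall s : 'I_l.+1, exists g : hermitian_ring F q,
    stage_J m ms s g /\ g *: \prod_(r < s) ('X - (stage_h m h r)%:P) = u s.
  by move=> s; have [g ? ?] := uJ s; exists g.
set p' := \sum_(s < _) _; suff [/startE] : fat_point_ideal ev (stage_mult m ms 0) p' /\
  (size p' <= l.+1)%N by split.
(* The coefficients, chosen for [s <= l], are extended by 0, which lies in every ideal. *)
apply/main; exists (fun s => if insub s is Some i then g i else 0) => [s|].
  case: insubP => [i _ <-|_]; first by apply/stageE; have [] := gJ i.
  by move=> P; apply: ideal_exp0.
by apply: eq_bigr => s _; rewrite valK; have [_ ->] := gJ s.
Qed.
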